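(* For every integer $m\geq 2$ the polynomial $$\prod_{j=0}^m \left(1+q^{8j+1}\right)\left(1+q^{8j+2}\right)\cdots\left(1+q^{8j+7}\right)$$ is unimodal.
   Context: A polynomial $a_0+a_1q+\cdots+a_Nq^N$ (of degree $N$) with integer coefficients is called unimodal if for some $0\leq j\leq N$ one has $a_0\leq a_1\leq\cdots\leq a_j\geq a_{j+1}\geq\cdots\geq a_N$. *)

(* Defs.v *)
From mathcomp Require Export all_boot all_order all_algebra.

Set Implicit Arguments.
Unset Strict Implicit.
Unset Printing Implicit Defensive.

Import Order.TTheory GRing.Theory Num.Theory.
Local Open Scope ring_scope.

(* The degree N of p is (size p).-1. *)
Definition unimodal (p : {poly int}) : Prop :=
  exists j : nat,
    [/\ (j <= (size p).-1)%N,
        forall i : nat, (i < j)%N -> p`_i <= p`_i.+1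
      & forall i : nat, (j <= i)%N -> (i < (size p).-1)%N -> p`_i.+1 <= p`_i].

(* Main.v *)
(** Up to a shift, the coefficients count the sign choices with [sum (+-a) = w],
    where [a] runs over the exponents.  Unimodality says that the decrements
    [gap w = signs (w - 1) - signs (w + 1)] are nonnegative for [w >= 0].
    As [gap] is odd in [w] and a new factor [1 + q^a] replaces [gap w] by
    [gap (w - a) + gap (w + a)], adding the factors one at a time leaves only
    the range [0 < w < a] to be treated.  There [gap w] is, up to a positive
    factor, a sum over the angles [x = k pi / M] in [[0, pi/2]] of
    [sin x * sin (w x) * prod cos (a x)].  The terms with [a x <= pi/2] for the
    largest [a] are nonnegative, and the term [k = 1] alone is of order
    [1 / M^2].  For larger [x], [(cos y)^2 <= 2/3 exp ((3 cos 2y - 1) / 4)] and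
    a Dirichlet kernel bound show that the product over [m] blocks is at most
    [4^-m].  This settles the induction beyond 18 blocks; the products of 3 to
    18 blocks are computed. *)

From Stdlib Require Import Reals ZArith Lra Lia List Bool Arith.
Import ListNotations.

Local Open Scope Z_scope.

(** * Signed sums *)

Fixpoint signs (l : list nat) (w : Z) : Z :=
  match l with
  | [] => if w =? 0 then 1 else 0
  | a :: l' => signs l' (w - Z.of_nat a) + signs l' (w + Z.of_nat a)
  end.

(** The coefficient of [q^w] in [q - 1/q] times the product of the Laurent factors [q^a + q^(-a)],
    for [a] in [l]. *)
Definition gap (l : list nat) (w : Z) : Z := signs l (w - 1) - signs l (w + 1).

Definition weight (l : list nat) : Z := Z.of_nat (list_sum l).

Lemma weight_cons a l : weight (a :: l) = Z.of_nat a + weight l.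
Proof. unfold weight; simpl; lia. Qed.

Lemma signs_opp l w : signs l (- w) = signs l w.
Proof.
revert w; induction l as [|a l IH]; intros w; simpl.
- destruct (Z.eqb_spec w 0), (Z.eqb_spec (- w) 0); lia.
- rewrite <- (IH (w - _)), <- (IH (w + _)), Z.add_comm.
  f_equal; f_equal; lia.
Qed.

Lemma signs_ge0 l w : 0 <= signs l w.
Proof.
revert w; induction l as [|a l IH]; intros w; simpl.
- destruct (Z.eqb w 0); lia.
- apply Z.add_nonneg_nonneg; apply IH.
Qed.

Lemma signs_weight l : 0 < signs l (weight l).
Proof.
induction l as [|a l IH]; [reflexivity|].
rewrite weight_cons; simpl.
replace (Z.of_nat a + weight l - Z.of_nat a) with (weight l) by lia.
generalize (signs_ge0 l (Z.of_nat a + weight l + Z.of_nat a)); lia.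
Qed.

Lemma signs_out l w : weight l < Z.abs w -> signs l w = 0.
Proof.
revert w; induction l as [|a l IH]; intros w; [|rewrite weight_cons]; simpl.
- unfold weight; simpl; destruct (Z.eqb_spec w 0); lia.
- intros H; rewrite !IH; lia.
Qed.

(** Changing one sign moves the sum by an even amount, so every attained sum has the parity of
    [weight l]. *)
Lemma signs_parity l w : Z.odd (w + weight l) = true -> signs l w = 0.
Proof.
revert w; induction l as [|a l IH]; intros w; [|rewrite weight_cons]; simpl.
- unfold weight; simpl; rewrite Z.add_0_r; destruct (Z.eqb_spec w 0); [subst; discriminate|reflexivity].
- intros H; rewrite !IH; [reflexivity| |].
  + now replace (w + Z.of_nat a + weight l) with (w + (Z.of_nat a + weight l)) by lia.
  + replace (w - Z.of_nat a + weight l) with (w + (Z.of_nat a + weight l) + 2 * (- Z.of_nat a)) by lia.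
    now rewrite Z.odd_add_mul_2.
Qed.

Lemma gap_opp l w : gap l (- w) = - gap l w.
Proof.
unfold gap.
replace (- w - 1) with (- (w + 1)) by lia; replace (- w + 1) with (- (w - 1)) by lia.
rewrite !signs_opp; lia.
Qed.

Lemma gap_0 l : gap l 0 = 0.
Proof. generalize (gap_opp l 0); simpl; lia. Qed.

Lemma gap_cons a l w : gap (a :: l) w = gap l (w - Z.of_nat a) + gap l (w + Z.of_nat a).
Proof.
unfold gap; simpl.
replace (w - 1 - Z.of_nat a) with (w - Z.of_nat a - 1) by lia.
replace (w - 1 + Z.of_nat a) with (w + Z.of_nat a - 1) by lia.
replace (w + 1 - Z.of_nat a) with (w - Z.of_nat a + 1) by lia.
replace (w + 1 + Z.of_nat a) with (w + Z.of_nat a + 1) by lia.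
lia.
Qed.

Lemma gap_parity l w : Z.even (w + weight l) = true -> gap l w = 0.
Proof.
intros H; unfold gap; rewrite !signs_parity; [reflexivity| |].
- replace (w + 1 + weight l) with (Z.succ (w + weight l)) by lia.
  now rewrite Z.odd_succ.
- replace (w - 1 + weight l) with (Z.pred (w + weight l)) by lia.
  now rewrite Z.odd_pred.
Qed.

(** If the exponents with sign plus add up to [i], the signed sum is [i - (weight l - i)]. *)
Definition coeff (l : list nat) (i : nat) : Z := signs l (2 * Z.of_nat i - weight l).

Lemma coeff_nil i : coeff [] i = if (i =? 0)%nat then 1 else 0.
Proof. destruct i; reflexivity. Qed.

Lemma coeff_cons a l i :
  coeff (a :: l) i = coeff l i + if (i <? a)%nat then 0 else coeff l (i - a).
Proof.
unfold coeff; rewrite weight_cons; cbn [signs].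
replace (2 * Z.of_nat i - (Z.of_nat a + weight l) + Z.of_nat a) with (2 * Z.of_nat i - weight l) by lia.
rewrite Z.add_comm; f_equal.
destruct (Nat.ltb_spec i a).
(* For [i < a] the argument lies below [- weight l], out of reach of the signed sums. *)
- rewrite signs_out; unfold weight; lia.
- f_equal; lia.
Qed.

Lemma coeff_ge0 l i : 0 <= coeff l i.
Proof. apply signs_ge0. Qed.

Lemma coeff_list_sum l : 0 < coeff l (list_sum l).
Proof.
unfold coeff; replace (2 * Z.of_nat (list_sum l) - weight l) with (weight l) by (unfold weight; lia).
apply signs_weight.
Qed.

(** The parameter [r] allows incomplete blocks, since the induction adds one factor at a time. *)
Fixpoint add_block (m r : nat) (l : list nat) : list nat :=
  match r with
  | O => l
  | S r' => (8 * m + r)%nat :: add_block m r' l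
  end.

Fixpoint blocks (n : nat) : list nat :=
  match n with O => [] | S m => add_block m 7 (blocks m) end.

Lemma weight_add_block m r l :
  2 * weight (add_block m r l) = 2 * weight l + Z.of_nat r * (16 * Z.of_nat m + Z.of_nat r + 1).
Proof.
induction r as [|r IH]; [simpl add_block; nia|].
change (add_block m (S r) l) with ((8 * m + S r)%nat :: add_block m r l).
rewrite weight_cons; nia.
Qed.

(** Block [m] weighs [28 (2m + 1)], and the first [n] odd numbers add up to [n^2]. *)
Lemma weight_blocks n : weight (blocks n) = 28 * Z.of_nat n * Z.of_nat n.
Proof.
induction n as [|m IH]; [reflexivity|].
change (blocks (S m)) with (add_block m 7 (blocks m)).
generalize (weight_add_block m 7 (blocks m)); nia.
Qed.

Lemma length_add_block m r l : length (add_block m r l) = (r + length l)%nat.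
Proof. induction r; simpl; lia. Qed.

Lemma length_blocks n : length (blocks n) = (7 * n)%nat.
Proof.
induction n as [|m IH]; [reflexivity|].
change (blocks (S m)) with (add_block m 7 (blocks m)).
rewrite length_add_block; lia.
Qed.

Lemma Forall_add_block m r l c :
  (8 * m + r <= c)%nat -> Forall (fun a => a <= c)%nat l ->
  Forall (fun a => a <= c)%nat (add_block m r l).
Proof. induction r; intros Hr Hl; [easy|]; constructor; auto with zarith; apply IHr; auto with zarith. Qed.

Lemma Forall_blocks n c : (8 * n <= c)%nat -> Forall (fun a => a <= c)%nat (blocks n).
Proof.
induction n as [|m IH]; intros H; [constructor|].
apply Forall_add_block; [lia|]; apply IH; lia.
Qed.

(** * Computation of the first products *)

Fixpoint add_lists (s t : list Z) : list Z :=
  match s, t with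
  | x :: s', y :: t' => x + y :: add_lists s' t'
  | [], _ => t
  | _, [] => s
  end.

(** Coefficient lists start at degree 0. With [s = t] this multiplies by [1 + q^a] in one pass. *)
Fixpoint add_shifted (a : nat) (s t : list Z) : list Z :=
  match a with
  | O => add_lists s t
  | S a' => match s with
            | [] => 0 :: add_shifted a' [] t
            | x :: s' => x :: add_shifted a' s' t
            end
  end.

Lemma nth_add_lists s t i : nth i (add_lists s t) 0 = nth i s 0 + nth i t 0.
Proof.
revert t i; induction s as [|x s IH]; intros [|y t] [|i]; simpl; try lia; apply IH.
Qed.

Lemma nth_add_shifted a s t i :
  nth i (add_shifted a s t) 0 = nth i s 0 + if (i <? a)%nat then 0 else nth (i - a) t 0.
Proof.
revert s i; induction a as [|a IH]; intros s i.
- simpl; rewrite nth_add_lists, Nat.sub_0_r; reflexivity.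
- destruct i as [|i].
  { change (0 <? S a)%nat with true; destruct s; simpl; lia. }
  change (S i <? S a)%nat with (i <? a)%nat; rewrite Nat.sub_succ.
  destruct s as [|x s]; simpl nth; rewrite IH; [|reflexivity].
  destruct i; reflexivity.
Qed.

Definition represents (s : list Z) (l : list nat) : Prop := forall i, nth i s 0 = coeff l i.

Lemma represents_cons a s l : represents s l -> represents (add_shifted a s s) (a :: l).
Proof. intros H i; rewrite nth_add_shifted, coeff_cons, !H; reflexivity. Qed.

Fixpoint block_coeffs (m r : nat) (s : list Z) : list Z :=
  match r with
  | O => s
  | S r' => let s' := block_coeffs m r' s in add_shifted (8 * m + r) s' s'
  end.

Lemma represents_add_block m r s l :
  represents s l -> represents (block_coeffs m r s) (add_block m r l).
Proof. intros H; induction r as [|r IH]; [exact H|]; now apply represents_cons. Qed.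

Fixpoint descending (x : Z) (s : list Z) : bool :=
  match s with y :: t => (y <=? x) && descending y t | [] => true end.

(** The list is read from half the degree, [14 n n], on: this is the half that corresponds to
    [w >= 0]. *)
Definition center_descending (n : nat) (s : list Z) : bool :=
  match skipn (14 * n * n) s with x :: t => descending x t | [] => true end.

(** Nonnegativity serves at the end of the list, where the next entry is the default 0. *)
Lemma descending_nth x s i : Forall (Z.le 0) (x :: s) ->
  descending x s = true -> nth (S i) (x :: s) 0 <= nth i (x :: s) 0.
Proof.
revert x i; induction s as [|y s IH]; intros x i Hp; inversion_clear Hp as [|? ? Hx Hs].
- intros _; destruct i as [|[|i]]; simpl; lia.
- intros [Hyx Hd]%andb_true_iff; apply Z.leb_le in Hyx.
  destruct i as [|i]; [exact Hyx|]; exact (IH y i Hs Hd).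
Qed.

Lemma center_descending_gap n s w : represents s (blocks n) ->
  center_descending n s = true -> 0 <= w -> 0 <= gap (blocks n) w.
Proof.
intros Hs Hd Hw.
destruct (Z.even (w + weight (blocks n))) eqn:Ev; [rewrite gap_parity; auto; lia|].
rewrite weight_blocks in Ev.
(* The weight is even, so only [w = 2i + 1] remains; there [gap] is the drop from coefficient
   [14 n n + i] to the next one. *)
assert (Hodd : Z.Odd w).
{ rewrite <- Z.odd_spec, <- Z.negb_even.
  replace (w + 28 * Z.of_nat n * Z.of_nat n) with (w + 2 * (14 * Z.of_nat n * Z.of_nat n)) in Ev by lia.
  now rewrite Z.even_add_mul_2 in Ev; rewrite Ev. }
destruct Hodd as [v ->].
assert (E : exists i, Z.of_nat i = v) by (exists (Z.to_nat v); lia).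
destruct E as [i <-].
assert (Hle : nth (14 * n * n + S i) s 0 <= nth (14 * n * n + i) s 0).
{ unfold center_descending in Hd; rewrite <- !nth_skipn.
  destruct (skipn (14 * n * n) s) as [|x t] eqn:Et; [destruct i; simpl; lia|].
  apply descending_nth; auto.
  apply Forall_forall; intros z Hz.
  rewrite <- Et in Hz; apply (In_nth _ _ 0) in Hz; destruct Hz as [j [_ <-]].
  rewrite nth_skipn, Hs; apply coeff_ge0. }
rewrite !Hs in Hle; unfold coeff in Hle; rewrite weight_blocks in Hle; unfold gap.
replace (2 * Z.of_nat i + 1 - 1) with (2 * Z.of_nat (14 * n * n + i) - 28 * Z.of_nat n * Z.of_nat n) by lia.
replace (2 * Z.of_nat i + 1 + 1) with (2 * Z.of_nat (14 * n * n + S i) - 28 * Z.of_nat n * Z.of_nat n) by lia.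
lia.
Qed.

Fixpoint check_blocks (k n : nat) (s : list Z) : bool :=
  match k with
  | O => true
  | S k' => let s' := block_coeffs n 7 s in
            center_descending (S n) s' && check_blocks k' (S n) s'
  end.

Lemma check_blocks_gap k n s : represents s (blocks n) -> check_blocks k n s = true ->
  forall p w, (n < p <= n + k)%nat -> 0 <= w -> 0 <= gap (blocks p) w.
Proof.
revert n s; induction k as [|k IH]; intros n s Hs Hc p w Hp Hw; [lia|].
assert (Hs' : represents (block_coeffs n 7 s) (blocks (S n))) by now apply represents_add_block.
cbn [check_blocks] in Hc; apply andb_true_iff in Hc; destruct Hc as [Hd Hc].
destruct (Nat.eq_dec p (S n)) as [->|Np].
- exact (center_descending_gap _ _ _ Hs' Hd Hw).
- apply (IH _ _ Hs' Hc); auto; lia.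
Qed.

(** The list of two blocks is the starting point and is not tested itself; 16 further blocks lead to
    18. *)
Lemma check_blocks_18 : check_blocks 16 2 (block_coeffs 1 7 (block_coeffs 0 7 [1])) = true.
Proof. vm_cast_no_check (eq_refl true). Qed.

Lemma gap_blocks_small n w : (3 <= n <= 18)%nat -> 0 <= w -> 0 <= gap (blocks n) w.
Proof.
intros Hn Hw; apply (check_blocks_gap 16 2 _) with (2 := check_blocks_18); [|lia|exact Hw].
apply represents_add_block, represents_add_block.
intros i; rewrite coeff_nil; destruct i as [|[|i]]; reflexivity.
Qed.

Local Close Scope Z_scope.
Local Open Scope R_scope.

(** * Fourier inversion *)

Definition cos_prod (l : list nat) (x : R) : R :=
  fold_right (fun a p => cos (INR a * x) * p) 1 l.

(** Telescoping of [2 sin x cos(2kx) = sin((2k+1)x) - sin((2k-1)x)]. *)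
Lemma sum_cos_dirichlet x K :
  2 * sin x * sum_f_R0 (fun k => cos (2 * (INR k * x))) K = sin ((2 * INR K + 1) * x) + sin x.
Proof.
induction K as [|K IH].
- simpl sum_f_R0; simpl INR.
  replace ((2 * 0 + 1) * x) with x by ring; replace (2 * (0 * x)) with 0 by ring.
  rewrite cos_0; ring.
- rewrite tech5, Rmult_plus_distr_l, IH, S_INR.
  replace ((2 * (INR K + 1) + 1) * x) with (2 * ((INR K + 1) * x) + x) by ring.
  replace ((2 * INR K + 1) * x) with (2 * ((INR K + 1) * x) - x) by ring.
  rewrite sin_plus, sin_minus; ring.
Qed.

Lemma sin_IZR_PI z : sin (IZR z * PI) = 0.
Proof. apply sin_eq_0_1; now exists z. Qed.

(** Orthogonality at the angles [k PI / M], [M = 2K + 1], over half a period. For [r <> 0] the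
    Dirichlet kernel reduces to [sin x], as [sin (M x) = 0]. *)
Lemma sum_cos_roots K r : (Z.abs r < 2 * Z.of_nat K + 1)%Z ->
  sum_f_R0 (fun k => cos (2 * (INR k * (IZR r * (PI / (2 * INR K + 1)))))) K
  = (if (r =? 0)%Z then (2 * INR K + 1) / 2 else 0) + / 2.
Proof.
intros Hr.
assert (HM : 0 < 2 * INR K + 1) by (generalize (pos_INR K); lra).
generalize (sum_cos_dirichlet (IZR r * (PI / (2 * INR K + 1))) K).
destruct (Z.eqb_spec r 0) as [->|Nr].
- intros _.
  rewrite (sum_eq _ (fun _ => 1)), sum_cte, S_INR; [lra|].
  intros k _; rewrite <- cos_0; f_equal; ring.
- replace ((2 * INR K + 1) * (IZR r * (PI / (2 * INR K + 1)))) with (IZR r * PI) by (field; lra).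
  rewrite sin_IZR_PI.
  set (x := IZR r * _).
  (* A zero of the sine would make [2K + 1] divide [r], against [0 < |r| < 2K + 1]. *)
  assert (Hs : sin x <> 0).
  { intros [z Hz]%sin_eq_0_0.
    assert (E : IZR r = IZR (z * (2 * Z.of_nat K + 1))).
    { rewrite mult_IZR, plus_IZR, mult_IZR, <- INR_IZR_INZ.
      apply (Rmult_eq_reg_r PI); [|apply PI_neq0].
      unfold x in Hz.
      replace (IZR z * (2 * INR K + 1) * PI) with ((IZR z * PI) * (2 * INR K + 1)) by ring.
      rewrite <- Hz; field; lra. }
    apply eq_IZR in E.
    destruct (Z.lt_trichotomy z 0) as [Hz0|[->|Hz0]]; nia. }
  intros E; apply (Rmult_eq_reg_l (2 * sin x)); [rewrite E; field|nra].
Qed.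

(** At [q = exp(ix)], up to constants, [q - 1/q] gives [sin x], each [q^a + q^(-a)] gives [cos(ax)],
    and [sin(wx)] extracts the coefficient, [gap] being odd. *)
Definition wave (l : list nat) (w : Z) (x : R) : R :=
  sin x * sin (IZR w * x) * cos_prod l x.

(** The counterpart of [gap_cons]; its factor 2 produces the power [2 ^ length l] in the inversion
    formula. *)
Lemma wave_cons a l w x :
  2 * wave (a :: l) w x = wave l (w - Z.of_nat a) x + wave l (w + Z.of_nat a) x.
Proof.
unfold wave; simpl; rewrite minus_IZR, plus_IZR, <- INR_IZR_INZ.
rewrite Rmult_minus_distr_r, Rmult_plus_distr_r, sin_minus, sin_plus; ring.
Qed.

(* The bound on [w] excludes aliasing. *)
Lemma gap_fourier K l w : Z.odd (w + weight l) = true ->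
  (Z.abs w + weight l < 4 * Z.of_nat K + 1)%Z ->
  IZR (gap l w) = 4 / (2 * INR K + 1) * 2 ^ length l *
    sum_f_R0 (fun k => wave l w (INR k * (PI / (2 * INR K + 1)))) K.
Proof.
assert (HM : 0 < 2 * INR K + 1) by (generalize (pos_INR K); lra).
revert w; induction l as [|a l IH]; intros w Ho Hw.
- change (weight []) with 0%Z in *; rewrite Z.add_0_r in *.
  apply Z.odd_spec in Ho; destruct Ho as [r ->].
  (* Here [2 sin x sin((2r+1)x) = cos(2rx) - cos(2(r+1)x)], and the extra [1/2] of the two root sums
     cancels. *)
  transitivity (4 / (2 * INR K + 1) * / 2 *
     (sum_f_R0 (fun k => cos (2 * (INR k * (IZR r * (PI / (2 * INR K + 1)))))) K
     - sum_f_R0 (fun k => cos (2 * (INR k * (IZR (r + 1) * (PI / (2 * INR K + 1)))))) K)).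
  + rewrite !sum_cos_roots by lia.
    unfold gap; cbn [signs].
    replace (2 * r + 1 - 1)%Z with (2 * r)%Z by lia.
    replace (2 * r + 1 + 1)%Z with (2 * (r + 1))%Z by lia.
    destruct (Z.eqb_spec r 0), (Z.eqb_spec (2 * r) 0), (Z.eqb_spec (r + 1) 0),
      (Z.eqb_spec (2 * (r + 1)) 0); try lia; rewrite minus_IZR; field; lra.
  + rewrite <- minus_sum, (Rmult_assoc _ (/ 2)), scal_sum; cbn [length pow]; rewrite Rmult_1_r.
    f_equal; apply sum_eq; intros k _; unfold wave; cbn [cos_prod fold_right].
    set (x := INR k * (PI / (2 * INR K + 1))).
    rewrite !plus_IZR, mult_IZR.
    replace (2 * (INR k * (IZR r * (PI / (2 * INR K + 1))))) with ((2 * IZR r + 1) * x - x)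
      by (unfold x; ring).
    replace (2 * (INR k * ((IZR r + 1) * (PI / (2 * INR K + 1))))) with ((2 * IZR r + 1) * x + x)
      by (unfold x; ring).
    rewrite cos_minus, cos_plus; field.
- rewrite weight_cons in *.
  rewrite gap_cons, plus_IZR, !IH; try lia.
  + cbn [length pow]; set (c := 4 / _).
    transitivity (c * 2 ^ length l *
      (2 * sum_f_R0 (fun k => wave (a :: l) w (INR k * (PI / (2 * INR K + 1)))) K)); [|ring].
    rewrite <- Rmult_plus_distr_l, <- plus_sum; f_equal; rewrite scal_sum.
    apply sum_eq; intros k _; rewrite <- wave_cons; ring.
  + now replace (w + Z.of_nat a + weight l)%Z with (w + (Z.of_nat a + weight l))%Z by lia.
  + replace (w - Z.of_nat a + weight l)%Z with (w + (Z.of_nat a + weight l) + 2 * (- Z.of_nat a))%Z by lia.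
    now rewrite Z.odd_add_mul_2.
Qed.

(** The term [k = 1] is kept whole, and each of the other [K] terms costs at most [t]. *)
Lemma sum_ge_second_term (T : nat -> R) (t : R) K : (1 <= K)%nat ->
  (forall k, (k <= K)%nat -> - t <= T k) ->
  T 1%nat - INR K * t <= sum_f_R0 T K.
Proof.
intros HK; induction K as [|[|K] IH]; intros HT; [lia| |].
- simpl; generalize (HT 0%nat (Nat.le_0_l _)); lra.
- rewrite tech5, S_INR.
  assert (H1 := HT (S (S K)) (Nat.le_refl _)).
  assert (H2 : T 1%nat - INR (S K) * t <= sum_f_R0 T (S K)).
  { apply IH; [lia|]; intros; apply HT; lia. }
  lra.
Qed.

(** * Estimates of the cosine product *)

(* [1 + u <= exp u] at [u = 3/2 (cos x)^2 - 1]: the weight 2/3 is close to the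
   mean of the squared cosines in the worst case. *)
Lemma cos_sq_le_exp x : (cos x) ^ 2 <= 2 / 3 * exp ((3 * cos (2 * x) - 1) / 4).
Proof.
generalize (exp_ineq1_le ((3 * cos (2 * x) - 1) / 4)); rewrite cos_2a_cos; lra.
Qed.

Definition cos_sum (l : list nat) (x : R) : R :=
  fold_right (fun a s => cos (2 * (INR a * x)) + s) 0 l.

Lemma cos_prod_sq_le_exp l x :
  (cos_prod l x) ^ 2 <= (2 / 3) ^ length l * exp ((3 * cos_sum l x - INR (length l)) / 4).
Proof.
induction l as [|a l IH].
- simpl; replace ((3 * 0 - 0) / 4) with 0 by field; rewrite exp_0; lra.
- simpl cos_prod; simpl cos_sum; cbn [length]; rewrite S_INR, Rpow_mult_distr.
  replace ((3 * (cos (2 * (INR a * x)) + cos_sum l x) - (INR (length l) + 1)) / 4)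
    with ((3 * cos (2 * (INR a * x)) - 1) / 4 + (3 * cos_sum l x - INR (length l)) / 4) by field.
  rewrite exp_plus; cbn [pow].
  replace (2 / 3 * (2 / 3) ^ length l *
      (exp ((3 * cos (2 * (INR a * x)) - 1) / 4) * exp ((3 * cos_sum l x - INR (length l)) / 4)))
    with (2 / 3 * exp ((3 * cos (2 * (INR a * x)) - 1) / 4) *
      ((2 / 3) ^ length l * exp ((3 * cos_sum l x - INR (length l)) / 4))) by ring.
  apply Rmult_le_compat; try apply pow2_ge_0; [apply cos_sq_le_exp|exact IH].
Qed.

(** Extra cosines do not increase the modulus, so the tail bound is needed for complete blocks
    only. *)
Lemma cos_prod_add_block m r l x :
  Rabs (cos_prod (add_block m r l) x) <= Rabs (cos_prod l x).
Proof.
induction r as [|r IH]; [apply Rle_refl|].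
change (cos_prod (add_block m (S r) l) x)
  with (cos (INR (8 * m + S r) * x) * cos_prod (add_block m r l) x); rewrite Rabs_mult.
assert (Hc : Rabs (cos (INR (8 * m + S r) * x)) <= 1) by (apply Rabs_le, COS_bound).
generalize (Rabs_pos (cos_prod (add_block m r l) x)); nra.
Qed.

(* Adding the missing multiple of 8 to each block makes the sum telescope. *)
Lemma cos_sum_blocks n x : 0 <= sin x ->
  2 * sin x * cos_sum (blocks n) x <= sin ((16 * INR n + 1) * x) - sin x + 2 * INR n * sin x.
Proof.
intros Hs; induction n as [|m IH].
- simpl; replace ((16 * 0 + 1) * x) with x by ring; lra.
- assert (Tel : forall y, 2 * sin x * cos (2 * y) = sin (2 * y + x) - sin (2 * y - x)).
  { intros y; rewrite sin_plus, sin_minus; ring. }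
  assert (H8 := Tel ((8 * INR m + 8) * x)).
  assert (H7 := Tel ((8 * INR m + 7) * x)).
  assert (H6 := Tel ((8 * INR m + 6) * x)).
  assert (H5 := Tel ((8 * INR m + 5) * x)).
  assert (H4 := Tel ((8 * INR m + 4) * x)).
  assert (H3 := Tel ((8 * INR m + 3) * x)).
  assert (H2 := Tel ((8 * INR m + 2) * x)).
  assert (H1 := Tel ((8 * INR m + 1) * x)).
  assert (B := proj1 (COS_bound (2 * ((8 * INR m + 8) * x)))).
  (* The cosine missing from the block is at least -1, which costs [2 sin x] per block. *)
  assert (B' : 0 <= sin x * (1 + cos (2 * ((8 * INR m + 8) * x)))) by (apply Rmult_le_pos; lra).
  unfold cos_sum; cbn [blocks add_block fold_right]; fold (cos_sum (blocks m) x).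
  rewrite !plus_INR, !mult_INR.
  replace (INR 8) with 8 by (simpl; ring); replace (INR 7) with 7 by (simpl; ring).
  replace (INR 6) with 6 by (simpl; ring); replace (INR 5) with 5 by (simpl; ring).
  replace (INR 4) with 4 by (simpl; ring); replace (INR 3) with 3 by (simpl; ring).
  replace (INR 2) with 2 by (simpl; ring); replace (INR 1) with 1 by (simpl; ring).
  rewrite S_INR.
  (* Once each lower end is written as the preceding upper end, the telescoping is a linear
     cancellation. *)
  replace (2 * ((8 * INR m + 8) * x) - x) with (2 * ((8 * INR m + 7) * x) + x) in H8 by ring.
  replace (2 * ((8 * INR m + 7) * x) - x) with (2 * ((8 * INR m + 6) * x) + x) in H7 by ring.
  replace (2 * ((8 * INR m + 6) * x) - x) with (2 * ((8 * INR m + 5) * x) + x) in H6 by ring.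
  replace (2 * ((8 * INR m + 5) * x) - x) with (2 * ((8 * INR m + 4) * x) + x) in H5 by ring.
  replace (2 * ((8 * INR m + 4) * x) - x) with (2 * ((8 * INR m + 3) * x) + x) in H4 by ring.
  replace (2 * ((8 * INR m + 3) * x) - x) with (2 * ((8 * INR m + 2) * x) + x) in H3 by ring.
  replace (2 * ((8 * INR m + 2) * x) - x) with (2 * ((8 * INR m + 1) * x) + x) in H2 by ring.
  replace (2 * ((8 * INR m + 1) * x) - x) with ((16 * INR m + 1) * x) in H1 by ring.
  replace ((16 * (INR m + 1) + 1) * x) with (2 * ((8 * INR m + 8) * x) + x) by ring.
  lra.
Qed.

Lemma sin_lower x : 0 <= x <= 1 -> x - x ^ 3 / 6 <= sin x.
Proof.
intros Hx.
assert (P := PI2_3_2).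
destruct (pre_sin_bound x 0 (proj1 Hx)) as [H _]; [lra|].
unfold sin_approx, sin_term in H; simpl in H.
lra.
Qed.

(** Taylor's bound on [[-2, 2]]; outside, the left side is below -1. *)
Lemma cos_lower x : 1 - x ^ 2 / 2 <= cos x.
Proof.
destruct (Rle_dec (- 2) x) as [H1|H1]; [destruct (Rle_dec x 2) as [H2|H2]|].
- destruct (pre_cos_bound x 0 H1 H2) as [H _].
  unfold cos_approx, cos_term in H; simpl in H; lra.
- generalize (proj1 (COS_bound x)); nra.
- generalize (proj1 (COS_bound x)); nra.
Qed.

Lemma cos_prod_ge0 l c x : Forall (fun a => a <= c)%nat l -> 0 <= x -> INR c * x <= PI / 2 ->
  0 <= cos_prod l x.
Proof.
intros Hl Hx Hc; induction Hl as [|a l Ha Hl IH]; simpl; [lra|].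
apply Rmult_le_pos; [|exact IH].
assert (P := PI2_3_2).
apply le_INR in Ha; generalize (pos_INR a); intros Ha0.
apply cos_ge_0; nra.
Qed.

Lemma cos_prod_le1 l x : cos_prod l x <= 1.
Proof.
apply Rle_trans with (1 := Rle_abs _).
induction l as [|a l IH]; simpl; [rewrite Rabs_R1; lra|].
rewrite Rabs_mult.
assert (Hc : Rabs (cos (INR a * x)) <= 1) by (apply Rabs_le, COS_bound).
generalize (Rabs_pos (cos_prod l x)); nra.
Qed.

(** Each cosine is at least [1 - e] with [e = (c x)^2 / 2], and [n] such factors multiply to at
    least [1 - n e], as in Bernoulli's inequality. *)
Lemma cos_prod_lower l c x : Forall (fun a => a <= c)%nat l -> 0 <= x -> INR c * x <= 1 ->
  1 - INR (length l) * ((INR c * x) ^ 2 / 2) <= cos_prod l x.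
Proof.
intros Hl Hx Hc; assert (P := PI2_3_2).
induction Hl as [|a l Ha Hl IH]; [simpl; lra|].
cbn [length]; rewrite S_INR; simpl cos_prod.
assert (Hp : 0 <= cos_prod l x) by (apply cos_prod_ge0 with c; auto; lra).
assert (Hp1 := cos_prod_le1 l x).
assert (Hcos := cos_lower (INR a * x)).
apply le_INR in Ha; generalize (pos_INR a); intros Ha0.
assert (Hax : (INR a * x) ^ 2 <= (INR c * x) ^ 2) by (apply pow_incr; nra).
assert (0 <= (INR c * x) ^ 2) by apply pow2_ge_0.
set (e := (INR c * x) ^ 2 / 2) in *.
assert (He : 1 - e <= cos (INR a * x)) by (unfold e; lra).
assert (0 <= e) by (unfold e; lra).
assert ((1 - e) * cos_prod l x <= cos (INR a * x) * cos_prod l x) by (apply Rmult_le_compat_r; lra).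
nra.
Qed.

(** Otherwise the cosine would be nonpositive at [31/20], where its Taylor polynomial of degree 6, a
    lower bound, is positive. *)
Lemma PI_gt : 31 / 10 < PI.
Proof.
apply Rnot_le_lt; intros H; assert (P := PI2_3_2).
assert (Hc : cos (31 / 20) <= 0) by (apply cos_le_0; lra).
destruct (pre_cos_bound (31 / 20) 1) as [Hl _]; [lra|lra|].
unfold cos_approx, cos_term in Hl; cbn [sum_f_R0 Nat.add Nat.mul] in Hl.
rewrite !INR_IZR_INZ in Hl; simpl in Hl; lra.
Qed.

Lemma PI_lt : PI < 32 / 10.
Proof.
apply Rnot_le_lt; intros H; assert (P := PI2_3_2).
assert (Hc : 0 <= cos (32 / 20)) by (apply cos_ge_0; lra).
destruct (pre_cos_bound (32 / 20) 0) as [_ Hu]; [lra|lra|].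
unfold cos_approx, cos_term in Hu; simpl in Hu; lra.
Qed.

(** The constant [7/3] is the one that makes the exponent in [cos_prod_sq_le_exp] nonpositive for
    [7 m] factors. *)
Lemma cos_sum_blocks_le m x : (18 <= m)%nat ->
  PI / 2 <= INR (8 * m + 7) * x -> x <= PI / 2 ->
  cos_sum (blocks m) x <= 7 / 3 * INR m.
Proof.
intros Hm Hx1 Hx2; assert (P := PI_gt); assert (P' := PI_lt).
rewrite plus_INR, mult_INR in Hx1.
replace (INR 8) with 8 in Hx1 by (simpl; ring); replace (INR 7) with 7 in Hx1 by (simpl; ring).
assert (Hm' := le_INR _ _ Hm); replace (INR 18) with 18 in Hm' by (simpl; ring).
set (L := 16 * INR m + 1).
assert (HL : 289 <= L) by (unfold L; lra).
assert (Hx0 : 0 < x) by nra.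
assert (Hs0 : 0 < sin x) by (apply sin_gt_0; lra).
assert (HC := cos_sum_blocks m x (Rlt_le _ _ Hs0)); fold L in HC.
assert (Key : sin (L * x) <= sin x * ((L + 5) / 6)).
(* The cut [62/10] is slightly above 6, so that [sin x >= sin (62/10 / L)] already exceeds
   [6 / (L + 5)], and below [2 PI], so that the sine is nonpositive from [PI] up to it. *)
{ destruct (Rle_lt_dec (62 / 10) (L * x)) as [Hbig|Hsmall].
  - apply Rle_trans with 1; [apply SIN_bound|].
    set (y := 62 / 10 / L).
    assert (HyL : y * L = 62 / 10) by (unfold y; field; lra).
    assert (Hy0 : 0 < y) by (unfold y; apply Rdiv_lt_0_compat; lra).
    assert (Hy : y <= 1 / 40) by nra.
    assert (Hyx : y <= x) by nra.
    assert (Hsy : y - y ^ 3 / 6 <= sin y) by (apply sin_lower; lra).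
    assert (Hsx : sin y <= sin x) by (apply sin_incr_1; lra).
    assert (y ^ 3 / 6 <= y * / 1000) by (simpl; nra).
    nra.
  - destruct (Rle_lt_dec PI (L * x)) as [Hpi|Hpi].
    + apply Rle_trans with 0; [apply sin_le_0; lra|nra].
    (* The lower bound on [x] gives [PI - L x <= 13 x], whereas [(L + 5) / 6] is at least 49. *)
    + rewrite <- sin_PI_x.
      assert (Hx : x <= 1 / 40) by nra.
      assert (Hsx : x - x ^ 3 / 6 <= sin x) by (apply sin_lower; lra).
      assert (x ^ 3 / 6 <= x * / 1000) by (simpl; nra).
      assert (sin (PI - L * x) < PI - L * x) by (apply sin_lt_x; lra).
      assert (PI - L * x <= 13 * x) by (unfold L; lra).
      nra. }
replace ((L + 5) / 6) with (8 / 3 * INR m + 1) in Key by (unfold L; field).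
apply (Rmult_le_reg_l (2 * sin x)); lra.
Qed.

(** By the bound on [cos_sum] the exponential is at most 1, and [(2/3)^7 <= (1/4)^2] settles each
    block. *)
Lemma cos_prod_blocks_tail m x : (18 <= m)%nat ->
  PI / 2 <= INR (8 * m + 7) * x -> x <= PI / 2 ->
  Rabs (cos_prod (blocks m) x) <= (/ 4) ^ m.
Proof.
intros Hm Hx1 Hx2.
assert (HC := cos_sum_blocks_le m x Hm Hx1 Hx2).
assert (H := cos_prod_sq_le_exp (blocks m) x).
rewrite length_blocks, mult_INR in H; replace (INR 7) with 7 in H by (simpl; ring).
apply Rsqr_incr_0; [|apply Rabs_pos|apply pow_le; lra].
rewrite <- Rsqr_abs, !Rsqr_pow2, <- pow_mult, Nat.mul_comm, pow_mult.
apply Rle_trans with (1 := H).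
assert (He : exp ((3 * cos_sum (blocks m) x - 7 * INR m) / 4) <= 1).
{ rewrite <- exp_0.
  destruct (Rle_lt_or_eq_dec ((3 * cos_sum (blocks m) x - 7 * INR m) / 4) 0) as [Hl|Hl];
    [lra|now apply Rlt_le, exp_increasing|rewrite Hl; lra]. }
rewrite pow_mult.
assert (Hp : ((2 / 3) ^ 7) ^ m <= ((/ 4) ^ 2) ^ m) by (apply pow_incr; lra).
assert (0 <= ((2 / 3) ^ 7) ^ m) by (apply pow_le; lra).
generalize (exp_pos ((3 * cos_sum (blocks m) x - 7 * INR m) / 4)); nra.
Qed.

(** With [X = m + 2], about [7 X^2] error terms of size [4^-m] must stay below a main term of order
    [1 / X^4]; hence the sixth power. *)
Lemma pow6_le_pow4 m : (18 <= m)%nat -> 370 * (INR m + 2) ^ 6 <= 4 ^ m.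
Proof.
induction 1 as [|m Hm IH].
- replace (INR 18) with 18 by (simpl; ring); lra.
- rewrite S_INR; apply le_INR in Hm; replace (INR 18) with 18 in Hm by (simpl; ring).
  simpl (4 ^ S m).
  apply Rle_trans with (4 * (370 * (INR m + 2) ^ 6)); [|lra].
  (* One step multiplies the sixth power by at most [(3/2)^3 = 27/8], less than 4. *)
  assert (H2 : (INR m + 1 + 2) ^ 2 <= 3 / 2 * (INR m + 2) ^ 2) by (simpl; nra).
  assert (H6 : ((INR m + 1 + 2) ^ 2) ^ 3 <= (3 / 2 * (INR m + 2) ^ 2) ^ 3)
    by (apply pow_incr; split; [apply pow2_ge_0|exact H2]).
  rewrite Rpow_mult_distr, <- !pow_mult in H6; simpl (2 * 3)%nat in H6.
  assert (0 <= (INR m + 2) ^ 6) by (apply pow_le; lra).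
  lra.
Qed.

(** * Positivity near the center *)

(** This is the range where [w] minus the newest exponent is negative, so that [gap_cons] gives no
    sign; Fourier inversion replaces it. *)
Lemma gap_middle m r w : (18 <= m)%nat -> (1 <= r <= 7)%nat -> (0 < w < Z.of_nat (8 * m + r))%Z ->
  (0 <= gap (add_block m r (blocks m)) w)%Z.
Proof.
intros Hm Hr Hw.
set (l := add_block m r (blocks m)).
destruct (Z.even (w + weight l)) eqn:Ev; [rewrite gap_parity; auto; lia|].
assert (Ht := weight_add_block m r (blocks m)); fold l in Ht; rewrite weight_blocks in Ht.
assert (Hl : Forall (fun a => a <= 8 * m + r)%nat l)
  by (apply Forall_add_block, Forall_blocks; lia).
assert (Hlen : length l = (r + 7 * m)%nat) by (unfold l; rewrite length_add_block, length_blocks; reflexivity).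
(* The weight is at most [28 (m + 1)^2], so [4 K = 28 (m + 2)^2] leaves room for [w] in the aliasing
   condition. *)
set (K := (7 * (m + 2) * (m + 2))%nat).
apply le_IZR; rewrite (gap_fourier K); [| |unfold K; nia].
2: now rewrite <- Z.negb_even, Ev.
assert (P := PI_gt); assert (P' := PI_lt).
assert (Hm' := le_INR _ _ Hm); replace (INR 18) with 18 in Hm' by (simpl; ring).
set (X := INR m + 2).
assert (HX : 20 <= X) by (unfold X; lra).
assert (HK : INR K = 7 * X * X).
{ unfold K; rewrite !mult_INR, plus_INR; simpl; unfold X; ring. }
set (M := 2 * INR K + 1).
assert (HM : M = 14 * X * X + 1) by (unfold M; rewrite HK; ring).
set (phi := PI / M).
assert (HMphi : M * phi = PI) by (unfold phi; field; nra).
assert (HM0 : 0 < M) by nra.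
assert (Hphi0 : 0 < phi) by (apply Rdiv_lt_0_compat; lra).
assert (Hr' : INR (8 * m + r) <= 8 * INR m + 7).
{ rewrite plus_INR, mult_INR; replace (INR 8) with 8 by (simpl; ring).
  generalize (le_INR r 7 (proj2 Hr)); replace (INR 7) with 7 by (simpl; ring); lra. }
assert (Hr0 := pos_INR (8 * m + r)).
assert (HwR : 1 <= IZR w <= INR (8 * m + r)).
{ rewrite INR_IZR_INZ; split; apply IZR_le; lia. }
set (tau := (/ 4) ^ m).
assert (Htau : 0 < tau) by (apply pow_lt; lra).
assert (Hsmall : (8 * INR m + 7) * phi <= 1).
{ apply (Rmult_le_reg_l M); [lra|].
  replace (M * ((8 * INR m + 7) * phi)) with ((8 * INR m + 7) * (M * phi)) by ring.
  rewrite HMphi, HM; unfold X; nra. }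
assert (Hsmall' : INR (8 * m + r) * phi <= 1) by nra.
assert (Hterm : forall k, (k <= K)%nat -> - tau <= wave l w (INR k * phi)).
{ intros k Hk; set (x := INR k * phi).
  assert (Hk0 := pos_INR k); apply le_INR in Hk.
  assert (Hx0 : 0 <= x) by (unfold x; nra).
  assert (HxM : M * x <= M * (PI / 2)).
  { unfold x; replace (M * (INR k * phi)) with (INR k * (M * phi)) by ring.
    rewrite HMphi; unfold M; nra. }
  assert (Hx2 : x <= PI / 2) by (apply Rmult_le_reg_l with M; auto).
  unfold wave.
  destruct (Rle_dec (INR (8 * m + r) * x) (PI / 2)) as [Hax|Hax].
  - apply Rle_trans with 0; [lra|].
    (* Since [w] is at most [8 m + r], the angle [w x] stays below [PI / 2] too. *)
    apply Rmult_le_pos; [apply Rmult_le_pos; apply sin_ge_0; nra|].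
    now apply cos_prod_ge0 with (8 * m + r)%nat.
  - assert (HT : Rabs (cos_prod l x) <= tau).
    { apply Rle_trans with (1 := cos_prod_add_block m r (blocks m) x).
      apply cos_prod_blocks_tail; auto.
      rewrite plus_INR, mult_INR; replace (INR 8) with 8 by (simpl; ring).
      replace (INR 7) with 7 by (simpl; ring); nra. }
    assert (Hss : Rabs (sin x * sin (IZR w * x)) <= 1).
    { rewrite Rabs_mult.
      assert (Rabs (sin x) <= 1) by (apply Rabs_le, SIN_bound).
      assert (Rabs (sin (IZR w * x)) <= 1) by (apply Rabs_le, SIN_bound).
      generalize (Rabs_pos (sin x)) (Rabs_pos (sin (IZR w * x))); nra. }
    assert (HA : Rabs (sin x * sin (IZR w * x) * cos_prod l x) <= tau).
    { rewrite Rabs_mult.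
      generalize (Rabs_pos (sin x * sin (IZR w * x))) (Rabs_pos (cos_prod l x)); nra. }
    generalize (Rle_abs (- (sin x * sin (IZR w * x) * cos_prod l x))); rewrite Rabs_Ropp; lra. }
(* The value [38/10] is just below [(309/100)^2 * 4/10]: two sines of at least about [PI / M] each,
   and a cosine product of at least [4/10]. *)
assert (Hmain : 38 / 10 <= M * M * wave l w (INR 1 * phi)).
{ rewrite Rmult_1_l; unfold wave.
  assert (Hphi1 : phi <= 1 / 100) by nra.
  (* A stand-in for [phi = PI / M] for which [M y] is rational. *)
  set (y := 31 / 10 / M).
  assert (HyM : M * y = 31 / 10) by (unfold y; field; lra).
  assert (Hy0 : 0 < y) by (unfold y; apply Rdiv_lt_0_compat; lra).
  assert (Hyphi : y <= phi) by (apply Rmult_le_reg_l with M; lra).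
  assert (Hsy : y - y ^ 3 / 6 <= sin y) by (apply sin_lower; lra).
  assert (Hsy' : sin y <= sin phi) by (apply sin_incr_1; lra).
  assert (y ^ 3 / 6 <= y * / 10000) by (simpl; nra).
  assert (Hs : 309 / 100 <= M * sin phi) by nra.
  assert (Hsw : sin phi <= sin (IZR w * phi)) by (apply sin_incr_1; nra).
  assert (Hp : 4 / 10 <= cos_prod l phi).
  { apply Rle_trans with (2 := cos_prod_lower l _ phi Hl (Rlt_le _ _ Hphi0) Hsmall').
    assert (Hn : INR (length l) <= 7 * X).
    { rewrite Hlen, plus_INR, mult_INR; generalize (le_INR r 7 (proj2 Hr)).
      replace (INR 7) with 7 by (simpl; ring); unfold X; lra. }
    (* From [8 X^2 phi <= 8 PI / 14] and [PI < 32/10]; together with [X >= 20] this keeps the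
       Bernoulli loss [7 X b^2 / 2] below [6/10]. *)
    assert (Hb : INR (8 * m + r) * phi * X <= 64 / 35).
    { apply Rle_trans with (8 * X * phi * X).
      - apply Rmult_le_compat_r; [lra|]; apply Rmult_le_compat_r; [lra|].
        unfold X; lra.
      - rewrite HM in HMphi; nra. }
    set (b := INR (8 * m + r) * phi) in *.
    assert (Hb0 : 0 <= b) by (apply Rmult_le_pos; lra).
    assert (Hb1 : b <= 92 / 1000) by nra.
    apply Rle_trans with (1 - 7 * X * (b ^ 2 / 2)).
    - replace (7 * X * (b ^ 2 / 2)) with (7 / 2 * b * (b * X)) by field; nra.
    - generalize (pow2_ge_0 b); nra. }
  assert (Hss : (309 / 100) ^ 2 <= (M * sin phi) * (M * sin (IZR w * phi))).
  { assert (Hs' : M * sin phi <= M * sin (IZR w * phi)) by (apply Rmult_le_compat_l; lra).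
    rewrite <- Rsqr_pow2; apply Rmult_le_compat; lra. }
  replace (M * M * (sin phi * sin (IZR w * phi) * cos_prod l phi))
    with ((M * sin phi) * (M * sin (IZR w * phi)) * cos_prod l phi) by ring.
  nra. }
(* Times [M^2], the error is at most [197 * 7 * X^6 * tau <= 1379/370], which is below [38/10]. *)
assert (Hfin : INR K * tau <= wave l w (INR 1 * phi)).
{ apply (Rmult_le_reg_l (M * M)); [nra|].
  apply Rle_trans with (2 := Hmain).
  assert (Hpow := pow6_le_pow4 m Hm); fold X in Hpow.
  assert (E : 4 ^ m * tau = 1).
  { unfold tau; rewrite <- Rpow_mult_distr, Rinv_r by lra; apply pow1. }
  assert (H6 : 370 * X ^ 6 * tau <= 1).
  { apply Rle_trans with (4 ^ m * tau); [apply Rmult_le_compat_r; lra|lra]. }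
  assert (HX2 : 20 * 20 <= X * X) by nra.
  assert (HMM : M * M <= 197 * X ^ 4).
  { rewrite HM; replace (X ^ 4) with (X * X * (X * X)) by ring; nra. }
  rewrite HK.
  apply Rle_trans with (197 * X ^ 4 * (7 * X * X * tau)).
  - apply Rmult_le_compat_r; [|exact HMM].
    apply Rmult_le_pos; [nra|lra].
  - replace (197 * X ^ 4 * (7 * X * X * tau)) with (197 * 7 * (X ^ 6 * tau)) by ring.
    lra. }
apply Rmult_le_pos.
- apply Rmult_le_pos; [apply Rlt_le, Rdiv_lt_0_compat; lra|apply pow_le; lra].
- apply Rle_trans with (2 := sum_ge_second_term _ tau K ltac:(unfold K; nia) Hterm); lra.
Qed.

(** For [w] at least the new exponent, both arguments in [gap_cons] are nonnegative; [w = 0] follows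
    from oddness and the rest from [gap_middle]. *)
Lemma gap_add_block m r w : (18 <= m)%nat -> (r <= 7)%nat ->
  (forall v, 0 <= v -> 0 <= gap (blocks m) v)%Z ->
  (0 <= w -> 0 <= gap (add_block m r (blocks m)) w)%Z.
Proof.
intros Hm Hr Hb; revert w; induction r as [|r IH]; intros w Hw; [now apply Hb|].
destruct (Z.eq_dec w 0) as [->|Nw]; [rewrite gap_0; lia|].
destruct (Z_lt_le_dec w (Z.of_nat (8 * m + S r))) as [Hlt|Hge].
- apply gap_middle; lia.
- change (add_block m (S r) (blocks m)) with ((8 * m + S r)%nat :: add_block m r (blocks m)).
  rewrite gap_cons; apply Z.add_nonneg_nonneg; apply IH; lia.
Qed.

Theorem gap_blocks n w : (3 <= n)%nat -> (0 <= w)%Z -> (0 <= gap (blocks n) w)%Z.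
Proof.
intros Hn; destruct (le_lt_dec n 18) as [Hn'|Hn']; [intros; apply gap_blocks_small; lia|].
revert w; induction n as [|m IH]; intros w Hw; [lia|].
(* The induction hypothesis starts beyond 18 blocks; at 18 the computation takes its place. *)
destruct (Nat.eq_dec m 18) as [->|Nm].
- apply gap_add_block; auto; intros; apply gap_blocks_small; lia.
- apply gap_add_block; auto; try lia; intros; apply IH; lia.
Qed.

Lemma list_sum_blocks n : list_sum (blocks n) = (28 * n * n)%nat.
Proof. generalize (weight_blocks n); unfold weight; lia. Qed.

Lemma coeff_blocks_sub n i : (coeff (blocks n) i - coeff (blocks n) (S i)
  = gap (blocks n) (2 * Z.of_nat i + 1 - 28 * Z.of_nat n * Z.of_nat n))%Z.
Proof. unfold gap, coeff; rewrite weight_blocks; f_equal; f_equal; lia. Qed.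

Lemma coeff_blocks_nonincreasing n i : (3 <= n)%nat -> (14 * n * n <= i)%nat ->
  (coeff (blocks n) (S i) <= coeff (blocks n) i)%Z.
Proof.
intros Hn Hi; assert (E := coeff_blocks_sub n i).
generalize (gap_blocks n (2 * Z.of_nat i + 1 - 28 * Z.of_nat n * Z.of_nat n) Hn); lia.
Qed.

Lemma coeff_blocks_nondecreasing n i : (3 <= n)%nat -> (i < 14 * n * n)%nat ->
  (coeff (blocks n) i <= coeff (blocks n) (S i))%Z.
Proof.
intros Hn Hi; assert (E := coeff_blocks_sub n i).
(* Below the center the argument is negative, and oddness of [gap] reflects it. *)
replace (2 * Z.of_nat i + 1 - 28 * Z.of_nat n * Z.of_nat n)%Z
  with (- (28 * Z.of_nat n * Z.of_nat n - 2 * Z.of_nat i - 1))%Z in E by lia.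
rewrite gap_opp in E.
generalize (gap_blocks n (28 * Z.of_nat n * Z.of_nat n - 2 * Z.of_nat i - 1) Hn); lia.
Qed.

Local Close Scope R_scope.

(** * Coefficients of the polynomial *)

Require Import Defs.
From mathcomp Require Import all_boot all_order all_algebra.
From mathcomp Require Import zify ssrZ.
Import Order.TTheory GRing.Theory Num.Theory.
Local Open Scope ring_scope.

Definition factor_prod (l : seq nat) : {poly int} := \prod_(a <- l) (1 + 'X^a).

(** Multiplication by [1 + 'X^a] obeys the recursion [coeff_cons]. *)
Lemma coef_factor_prod l i : Z_of_int (factor_prod l)`_i = coeff l i.
Proof.
elim: l i => [|a l IH] i; rewrite /factor_prod ?big_nil ?big_cons.
  by rewrite coef1 coeff_nil; case: i.
rewrite -/(factor_prod l) mulrDl mul1r coefD coefXnM coeff_cons -!IH minusE.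
by case: ltnP => hia; case: Nat.ltb_spec => hia'; lia.
Qed.

Lemma factor_prod_add_block m r l :
  factor_prod (add_block m r l) = (\prod_(1 <= k < r.+1) (1 + 'X^(8 * m + k))) * factor_prod l.
Proof.
elim: r => [|r IH]; first by rewrite big_nil mul1r.
by rewrite big_nat_recr //= mulrAC -IH mulrC /factor_prod big_cons.
Qed.

Lemma factor_prod_blocks n :
  factor_prod (blocks n) = \prod_(0 <= j < n) \prod_(1 <= k < 8) (1 + 'X^(8 * j + k)).
Proof.
elim: n => [|n IH]; first by rewrite /factor_prod !big_nil.
by rewrite big_nat_recr //= -IH mulrC -factor_prod_add_block.
Qed.

Theorem corollary1p4 (m : nat) (hm : (2 <= m)%N) :
  unimodal (\prod_(0 <= j < m.+1) \prod_(1 <= k < 8) (1 + 'X^(8 * j + k))).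
Proof.
rewrite -factor_prod_blocks; set n := m.+1; set p := factor_prod _.
(* The coefficient of degree [28 n n] is positive, which puts the peak [14 n n] within the
   degree. *)
have size_p : (28 * n * n < size p)%N.
  rewrite ltnNge; apply/negP => /leq_sizeP/(_ _ (leqnn _)) p0.
  have := coeff_list_sum (blocks n); rewrite list_sum_blocks -coef_factor_prod.
  by rewrite [nth _ _ _]p0.
exists (14 * n * n)%N; split=> [|i hi|i hi _]; first by lia.
- have := @coeff_blocks_nondecreasing n i; rewrite -!coef_factor_prod -/p; lia.
- have := @coeff_blocks_nonincreasing n i; rewrite -!coef_factor_prod -/p; lia.
Qed.
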